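(* Let $\mathbb{H}=\{a^r b^s : 0\le r\le 3,\ 0\le s\le 1\}$ be the quaternion group of order $8$ with identity $e$. In the group ring $\mathbb{Z}_3[\mathbb{H}]$ put $$C=\{\lambda(e+a+a^2+a^3+b+ab+a^2b+a^3b):\lambda\in\mathbb{Z}_3\},$$ $$B=\{\lambda(e+a+a^2+a^3+2b+2ab+2a^2b+2a^3b):\lambda\in\mathbb{Z}_3\},$$ $$F=\{\lambda(e+2a+a^2+2a^3+b+2ab+a^2b+2a^3b):\lambda\in\mathbb{Z}_3\},$$ $$G=\{\lambda(e+2a+a^2+2a^3+2b+ab+2a^2b+a^3b):\lambda\in\mathbb{Z}_3\},$$ $$I(\langle a^2\rangle)=\{\alpha_1(2e+a^2)+\alpha_2(2a+a^3)+\alpha_3(2b+a^2b)+\alpha_4(2ab+a^3b):\alpha_i\in\mathbb{Z}_3\}.$$ Then $\mathbb{Z}_3[\mathbb{H}]$ decomposes as the direct sum of ideals $$\mathbb{Z}_3[\mathbb{H}]=C\oplus B\oplus F\oplus G\oplus I(\langle a^2\rangle),$$ and using this decomposition one can get any ideal of $\mathbb{Z}_3[\mathbb{H}]$.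
   Context: The quaternion group is generated by $a=i$, $b=j$ with $a^4=b^4=e$, $a^2=b^2$, $aba=b$. $\mathbb{Z}_3$ is the field with three elements and $\mathbb{Z}_3[\mathbb{H}]$ is the group ring of $\mathbb{H}$ over it. *)

(* Defs.v *)
From HB Require Import structures.
From mathcomp Require Import all_boot all_order all_fingroup all_algebra.
From mathcomp Require Import all_solvable all_field all_character.

Set Implicit Arguments.
Unset Strict Implicit.
Unset Printing Implicit Defensive.

Import GRing.Theory.
Local Open Scope ring_scope.

(* Elements of the group ring Z_3[H] are, as in mxrepresentation, the matrices
   in the algebra [group_ring 'F_3 H], on the basis [gr H x], x \in H; products
   are products [*m] of matrices, with gr H (x * y) = gr H x *m gr H y on H.
   A set of elements closed under linear combinations is represented by a matrix
   whose rows span it, [(A \in V)%MS] standing for membership. *)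
Definition gr (gT : finGroupType) (H : {group gT}) (x : gT) : 'M['F_3]_#|H| :=
  regular_repr 'F_3 H x.

(* All the linear combinations of the elements of s (see mem_lspan1, mem_lspan4).
   The outer << >> hides the sum from mxdirect, which would otherwise also demand
   that the lines spanned by the elements of s be independent. *)
Definition lspan (n : nat) (s : seq 'M['F_3]_n) : 'A['F_3]_n :=
  <<(\sum_(u <- s) <<mxvec u>>)%MS>>%MS.

(* [mx_ideal R J] does not by itself require J to be included in R. *)
Definition gr_ideal (gT : finGroupType) (H : {group gT}) (m : nat)
    (J : 'A['F_3]_(m, #|H|)) : bool :=
  (J <= group_ring 'F_3 H)%MS && mx_ideal (group_ring 'F_3 H) J.

Definition idC (gT : finGroupType) (H : {group gT}) (a b : gT) :
    'A['F_3]_#|H| :=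
  let g := gr H in
  lspan [:: g 1%g + g a + g (a ^+ 2)%g + g (a ^+ 3)%g
            + g b + g (a * b)%g + g (a ^+ 2 * b)%g + g (a ^+ 3 * b)%g].

Definition idB (gT : finGroupType) (H : {group gT}) (a b : gT) :
    'A['F_3]_#|H| :=
  let g := gr H in
  lspan [:: g 1%g + g a + g (a ^+ 2)%g + g (a ^+ 3)%g
            + 2 *: g b + 2 *: g (a * b)%g
            + 2 *: g (a ^+ 2 * b)%g + 2 *: g (a ^+ 3 * b)%g].

Definition idF (gT : finGroupType) (H : {group gT}) (a b : gT) :
    'A['F_3]_#|H| :=
  let g := gr H in
  lspan [:: g 1%g + 2 *: g a + g (a ^+ 2)%g + 2 *: g (a ^+ 3)%g
            + g b + 2 *: g (a * b)%g
            + g (a ^+ 2 * b)%g + 2 *: g (a ^+ 3 * b)%g].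

Definition idG (gT : finGroupType) (H : {group gT}) (a b : gT) :
    'A['F_3]_#|H| :=
  let g := gr H in
  lspan [:: g 1%g + 2 *: g a + g (a ^+ 2)%g + 2 *: g (a ^+ 3)%g
            + 2 *: g b + g (a * b)%g
            + 2 *: g (a ^+ 2 * b)%g + g (a ^+ 3 * b)%g].

(* The ideal written I(<a^2>). *)
Definition idI (gT : finGroupType) (H : {group gT}) (a b : gT) :
    'A['F_3]_#|H| :=
  let g := gr H in
  lspan [:: 2 *: g 1%g + g (a ^+ 2)%g;
            2 *: g a + g (a ^+ 3)%g;
            2 *: g b + g (a ^+ 2 * b)%g;
            2 *: g (a * b)%g + g (a ^+ 3 * b)%g].

Lemma grM (gT : finGroupType) (H : {group gT}) :
  {in H &, forall x y, gr H (x * y)%g = gr H x *m gr H y}.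
Proof. by move=> x y Hx Hy; rewrite /gr repr_mxM. Qed.

Lemma mem_lspan1 (n : nat) (u A : 'M['F_3]_n) :
  (A \in lspan [:: u])%MS <-> exists l : 'F_3, A = l *: u.
Proof.
rewrite /lspan big_seq1 !genmxE; split=> [/sub_rVP[l]|[l ->]].
  by rewrite -linearZ => /(can_inj mxvecK) ->; exists l.
by rewrite linearZ scalemx_sub.
Qed.

Lemma mem_lspan_cons (n : nat) (u A : 'M['F_3]_n) (s : seq 'M['F_3]_n) :
  (A \in lspan (u :: s))%MS <->
  exists l : 'F_3, exists2 B, (B \in lspan s)%MS & A = l *: u + B.
Proof.
rewrite /lspan genmxE big_cons; split=> [|[l [B sB ->]]].
  case/sub_addsmxP=> -[v w] /= eqA.
  have /sub_rVP[l El]: (v *m <<mxvec u>> <= mxvec u)%MS.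
    by rewrite -(genmxE (mxvec u)) submxMl.
  exists l; exists (vec_mx (w *m (\sum_(u <- s) <<mxvec u>>)%MS)).
    by rewrite vec_mxK genmxE submxMl.
  by apply: (can_inj mxvecK); rewrite linearD linearZ /= vec_mxK eqA El.
rewrite genmxE in sB; rewrite linearD linearZ addmx_sub_adds //.
by rewrite scalemx_sub ?genmxE.
Qed.

Lemma mem_lspan4 (n : nat) (u1 u2 u3 u4 A : 'M['F_3]_n) :
  (A \in lspan [:: u1; u2; u3; u4])%MS <->
  exists l1 l2 l3 l4 : 'F_3,
    A = l1 *: u1 + l2 *: u2 + l3 *: u3 + l4 *: u4.
Proof.
split=> [|[l1 [l2 [l3 [l4 ->]]]]].
  case/mem_lspan_cons=> l1 [A1 /mem_lspan_cons[l2 [A2 /mem_lspan_cons[l3 [A3]]]]].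
  move=> /mem_lspan1[l4 ->] -> -> ->.
  by exists l1, l2, l3, l4; rewrite !addrA.
rewrite -!addrA.
apply/mem_lspan_cons; exists l1; eexists; last by [].
apply/mem_lspan_cons; exists l2; eexists; last by [].
apply/mem_lspan_cons; exists l3; eexists; last by [].
by apply/mem_lspan1; exists l4.
Qed.

(* Main.v *)
Require Import Defs.
From HB Require Import structures.
From mathcomp Require Import all_boot all_order all_fingroup all_algebra.
From mathcomp Require Import all_solvable all_field all_character.
From mathcomp Require Import ring.

(** Multiplying an element v of an ideal J by 1 = sum of e_K, with e_K in the
    ideal K, writes v as a sum of elements of J :&: K; when each K contains no
    smaller nonzero ideal, J is the sum of those K that are included in J.
    Here C, B, F, G are lines on which a and b act by a sign, whereas
    I(<a^2>), where a^2 acts as -1, is the algebra of quaternions over Z_3; it is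
    simple, since combining v with its conjugates by a, b and ab isolates each
    of the four coordinates of v.  The sum is direct because the dimensions add
    up to 8. *)

(** * Ideals of a group ring over Z_3 as sums of minimal ideals *)

Section GroupRing.

Import GRing.Theory.
Local Open Scope ring_scope.

Context {gT : finGroupType} (H : {group gT}).

Local Notation R := (group_ring 'F_3 H).

Lemma lspan_linear {n m} (f : {linear 'M['F_3]_n -> 'M['F_3]_n})
    {s : seq 'M_n} {J : 'A_(m, n)} :
  (forall u, u \in s -> (f u \in J)%MS) ->
  forall A, (A \in lspan s)%MS -> (f A \in J)%MS.
Proof.
elim: s => [_ A | u s IHs sJ A /mem_lspan_cons[l [B sB ->]]].
  rewrite /lspan big_nil !genmxE submx0 mxvec_eq0 => /eqP->.
  by rewrite linear0 linear0 sub0mx.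
rewrite linearD linearZ linearD linearZ /= addmx_sub ?scalemx_sub //.
  by rewrite sJ ?mem_head.
by apply: IHs => // v sv; rewrite sJ // inE sv orbT.
Qed.

Lemma lspan_sub {n m} (s : seq 'M['F_3]_n) (J : 'A_(m, n)) :
  (forall u, u \in s -> (u \in J)%MS) -> (lspan s <= J)%MS.
Proof. by move=> sJ; apply/memmx_subP; exact: (lspan_linear idfun). Qed.

Lemma mem_lspan {n} (s : seq 'M['F_3]_n) u : u \in s -> (u \in lspan s)%MS.
Proof.
elim: s => //= v s IHs; rewrite inE => /predU1P[-> | /IHs su].
  apply/mem_lspan_cons; exists 1, 0; rewrite ?scale1r ?addr0 //.
  by rewrite linear0 sub0mx.
by apply/mem_lspan_cons; exists 0, u; rewrite ?scale0r ?add0r.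
Qed.

(** This upper bound is all that the dimension count behind the direct sum requires. *)
Lemma rank_lspan {n} (s : seq 'M['F_3]_n) : (\rank (lspan s) <= size s)%N.
Proof.
rewrite /lspan genmxE; elim: s => [|u s IHs]; first by rewrite big_nil mxrank0.
rewrite big_cons (leq_trans (mxrank_adds_leqif _ _)) //=.
by apply: (@leq_add _ _ 1) => //; rewrite genmxE rank_leq_row.
Qed.

Lemma mem_gr x : x \in H -> (gr H x \in R)%MS.
Proof. exact: envelop_mx_id. Qed.

Lemma gr1 : gr H 1%g = 1%:M. Proof. exact: repr_mx1. Qed.

Lemma gr_ideal_sub {m} (J : 'A_(m, #|H|)) : gr_ideal J -> (J <= R)%MS.
Proof. by case/andP. Qed.

Lemma gr_ideal_mull {m} (J : 'A_(m, #|H|)) A v :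
  gr_ideal J -> (A \in R)%MS -> (v \in J)%MS -> (A *m v \in J)%MS.
Proof. by case/and3P=> _ /mulsmx_subP lJ _; apply: lJ. Qed.

Lemma gr_ideal_mulr {m} (J : 'A_(m, #|H|)) A v :
  gr_ideal J -> (A \in R)%MS -> (v \in J)%MS -> (v *m A \in J)%MS.
Proof. by case/and3P=> _ _ /mulsmx_subP rJ RA Jv; apply: rJ. Qed.

Lemma gr_ideal_group_ring : gr_ideal R.
Proof.
rewrite /gr_ideal submx_refl /=.
by apply/andP; split; apply/mulsmx_subP=> A B; apply: envelop_mxM.
Qed.

(** In a finite group each element of [<<X>>] is a product of elements of [X], without inverses.
    Induction on the number of factors then reduces absorption of [R] to generators acting on
    spanning elements. *)
Lemma gr_ideal_lspan (X : {set gT}) (s : seq 'M_#|H|) :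
  H \subset <<X>>%g -> X \subset H ->
  (forall u, u \in s -> (u \in R)%MS) ->
  (forall x u, x \in X -> u \in s -> (gr H x *m u \in lspan s)%MS) ->
  (forall x u, x \in X -> u \in s -> (u *m gr H x \in lspan s)%MS) ->
  gr_ideal (lspan s).
Proof.
move=> genX sXH Rs lXs rXs; apply/and3P; split; first exact: lspan_sub.
  apply/mulsmx_subP=> _ v /envelop_mxP[c ->] sv.
  rewrite mulmx_suml linear_sum summx_sub // => x Hx.
  rewrite -scalemxAl linearZ scalemx_sub // -/(gr H x).
  have /gen_prodgP[n [y Xy ->]] := subsetP genX x Hx.
  elim: n y Xy => [|n IHn] y Xy; first by rewrite big_ord0 gr1 mul1mx.
  have Hy i : y i \in H by apply: (subsetP sXH).
  rewrite big_ord_recl grM ?group_prod // -mulmxA.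
  have lsy := lspan_linear (mulmx (gr H (y ord0))) (fun u => lXs _ u (Xy _)).
  by apply/lsy/IHn.
apply/mulsmx_subP=> v _ sv /envelop_mxP[c ->].
rewrite mulmx_sumr linear_sum summx_sub // => x Hx.
rewrite -scalemxAr linearZ scalemx_sub // -/(gr H x).
have /gen_prodgP[n [y Xy ->]] := subsetP genX x Hx.
elim: n y v sv Xy => [|n IHn] y v sv Xy; first by rewrite big_ord0 gr1 mulmx1.
have Hy i : y i \in H by apply: (subsetP sXH).
rewrite big_ord_recl grM ?group_prod // mulmxA.
have rsy := lspan_linear (mulmxr (gr H (y ord0))) (fun u => rXs _ u (Xy _)).
by apply: IHn => //; apply: rsy.
Qed.

(** For an ideal [K] this says that [K] contains no smaller nonzero ideal, as one sees by
    intersecting with [J]. Phrasing it through a common element [v] lets it apply directly to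
    products. *)
Definition gr_minimal (K : 'A['F_3]_#|H|) : Prop :=
  forall m (J : 'A_(m, #|H|)) v,
    gr_ideal J -> (v \in J)%MS -> (v \in K)%MS -> v != 0 -> (K <= J)%MS.

Lemma gr_minimal_line u : gr_minimal (lspan [:: u]).
Proof.
move=> m J v _ Jv /mem_lspan1[l v_lu] nz_v; apply: lspan_sub => w.
have nz_l: l != 0 by apply: contraNneq nz_v => l0; rewrite v_lu l0 scale0r.
rewrite inE => /eqP->.
by rewrite -(scalerK nz_l u) -v_lu linearZ scalemx_sub.
Qed.

(** If [B] is the component of [A] in [K], then [B *m v] lies in both [K] and [J]: either it
    vanishes, or minimality puts [K] inside [J]. A general [A], instead of 1, lets the induction
    drop one component at a time. *)
Lemma mem_sum_minimal_ideals (Ks : seq 'A['F_3]_#|H|) {m} (J : 'A_(m, #|H|)) :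
  (forall K, K \in Ks -> gr_ideal K /\ gr_minimal K) -> gr_ideal J ->
  forall A v, (A \in \sum_(K <- Ks) K)%MS -> (v \in J)%MS ->
  (A *m v \in \sum_(K <- [seq K <- Ks | (K <= J)%MS]) K)%MS.
Proof.
move=> + idJ; elim: Ks => [_ | K Ks IHs minKs] A v.
  rewrite big_nil submx0 mxvec_eq0 => /eqP-> _.
  by rewrite mul0mx linear0 sub0mx.
rewrite big_cons => /memmx_addsP[[B D] /= [KB sD ->]] Jv.
have [idK minK] := minKs K (mem_head _ _).
have{IHs} sDv: (D *m v \in \sum_(L <- [seq L <- Ks | (L <= J)%MS]) L)%MS.
  by apply: IHs => // L sL; apply: minKs; rewrite inE sL orbT.
have KBv : (B *m v \in K)%MS.
  by rewrite gr_ideal_mulr // (submx_trans Jv) ?gr_ideal_sub.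
have JBv : (B *m v \in J)%MS.
  by rewrite gr_ideal_mull // (submx_trans KB) ?gr_ideal_sub.
rewrite mulmxDl /=; have [Bv0 | nzBv] := eqVneq (B *m v) 0.
  rewrite Bv0 add0r; case: ifP => // _.
  by rewrite big_cons (submx_trans sDv) ?addsmxSr.
by rewrite (minK _ _ _ idJ JBv) // big_cons linearD addmx_sub_adds.
Qed.

Lemma minimal_ideals_decomposition (Ks : seq 'A['F_3]_#|H|) :
  (forall K, K \in Ks -> gr_ideal K /\ gr_minimal K) ->
  (1%:M \in \sum_(K <- Ks) K)%MS ->
  (\sum_(K <- Ks) K :=: R)%MS /\
  forall m (J : 'A_(m, #|H|)), gr_ideal J ->
    exists2 s, subseq s Ks & (J :=: \sum_(K <- s) K)%MS.
Proof.
move=> minKs Ks1.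
have decJ m (J : 'A_(m, #|H|)) : gr_ideal J ->
    (J :=: \sum_(K <- [seq K <- Ks | (K <= J)%MS]) K)%MS.
  move=> idJ; apply/eqmxP/andP; split.
    apply/memmx_subP=> v Jv; rewrite -[v]mul1mx.
    exact: mem_sum_minimal_ideals.
  rewrite big_filter; elim/big_ind: _ => [|K L KJ LJ|//]; first exact: sub0mx.
  by rewrite addsmx_sub KJ.
split=> [|m J idJ]; last by eexists; [apply: filter_subseq | apply: decJ].
(* Take [J] to be [R] itself: it contains every ideal, so the filter discards nothing. *)
apply: eqmx_trans (eqmx_sym (decJ _ _ gr_ideal_group_ring)).
rewrite (_ : filter _ _ = Ks) //; apply/all_filterP/allP=> K /minKs[idK _].
exact: gr_ideal_sub.
Qed.

End GroupRing.

(** * Computations in the group ring from the quaternion relations *)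

Section Quaternion.

Import GRing.Theory.
Local Open Scope ring_scope.

Context {gT : finGroupType} {H : {group gT}} {a b : gT}.
Hypotheses (Ha : a \in H) (Hb : b \in H) (genH : H \subset <<[set a; b]>>%g).
Hypotheses (a4 : (a ^+ 4 = 1)%g) (a2b2 : (a ^+ 2 = b ^+ 2)%g).
Hypothesis abab : (a * b * a = b)%g.

Local Notation R := (group_ring 'F_3 H).
Local Notation g := (gr H).

Definition qgr r s := g (a ^+ r * b ^+ s)%g.

Lemma qgr_id r s : (qgr r s \in R)%MS.
Proof. by rewrite mem_gr // groupM ?groupX. Qed.

Lemma qgr_a4 r s : qgr r.+4 s = qgr r s.
Proof. by rewrite /qgr -addn4 expgD a4 mulg1. Qed.

Lemma qgr_b2 r s : qgr r s.+2 = qgr r.+2 s.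
Proof.
by congr (g _); rewrite -[s.+2]add2n -[r.+2]addn2 !expgD a2b2 mulgA.
Qed.

Lemma quat_ba : (b * a = a ^+ 3 * b)%g.
Proof. by rewrite -{2}abab !mulgA -expgSr a4 mul1g. Qed.

Lemma mul_a_qgr r s : g a *m qgr r s = qgr r.+1 s.
Proof. by rewrite /qgr -grM ?groupM ?groupX // mulgA -expgS. Qed.

(** Moving [b] past [a ^+ r] triples the exponent. The cases r < 4 are listed with 3r reduced modulo
    4, to serve as rewriting rules. *)
Lemma mul_b_qgr s :
  (g b *m qgr 0 s = qgr 0 s.+1) * (g b *m qgr 1 s = qgr 3 s.+1) *
  (g b *m qgr 2 s = qgr 2 s.+1) * (g b *m qgr 3 s = qgr 1 s.+1).
Proof.
have mul_b r : g b *m qgr r s = qgr (3 * r) s.+1.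
  rewrite /qgr -grM ?groupM ?groupX // mulgA expgS mulgA; congr (g (_ * _)%g).
  elim: r => [|r IHr]; first by rewrite muln0 !expg0 mul1g mulg1.
  by rewrite expgSr mulgA IHr -mulgA quat_ba mulgA -expgD mulnSr.
by rewrite !mul_b !qgr_a4.
Qed.

Lemma mul_qgr_b r s : qgr r s *m g b = qgr r s.+1.
Proof. by rewrite /qgr -grM ?groupM ?groupX // -mulgA -expgSr. Qed.

Lemma mul_qgr_a r :
  (qgr r 0 *m g a = qgr r.+1 0) * (qgr r 1 *m g a = qgr r.+3 1).
Proof.
rewrite /qgr -!grM ?groupM ?groupX //; split; congr (g _).
  by rewrite !expg0 !mulg1 -expgSr.
by rewrite expg1 -mulgA quat_ba mulgA -expgD addn3.
Qed.

Lemma qgr00 : qgr 0 0 = 1%:M.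
Proof. by rewrite /qgr mulg1 gr1. Qed.

(** For signs [eps] and [del], this is the sum of chi(x) x over the eight words x, where chi is the
    linear character taking these values at [a] and [b]. *)
Definition quat_char (eps del : 'F_3) : 'M_#|H| :=
  qgr 0 0 + eps *: qgr 1 0 + qgr 2 0 + eps *: qgr 3 0
  + del *: qgr 0 1 + (eps * del) *: qgr 1 1
  + del *: qgr 2 1 + (eps * del) *: qgr 3 1.

(** As 2 = -1, this is (a^2 - 1) a^r b^s, which a^2 multiplies by -1. *)
Definition quat_anti r s : 'M_#|H| := 2 *: qgr r s + qgr r.+2 s.

Definition qgr_mul :=
  (mul_a_qgr, mul_b_qgr, mul_qgr_b, mul_qgr_a, qgr_b2, qgr_a4).

Lemma quat_charM eps del : eps ^+ 2 = 1 -> del ^+ 2 = 1 ->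
  [/\ g a *m quat_char eps del = eps *: quat_char eps del,
      g b *m quat_char eps del = del *: quat_char eps del,
      quat_char eps del *m g a = eps *: quat_char eps del
    & quat_char eps del *m g b = del *: quat_char eps del].
Proof.
move=> e2 d2; rewrite /quat_char.
(* Once the words are abstracted and the multiplication table applied, each equation holds entry by
   entry as a commutative ring identity modulo [e2] and [d2]. *)
move: qgr (g a) (g b) qgr_mul => q ga gb qM.
rewrite !mulmxDl !mulmxDr -!scalemxAl -!scalemxAr !qM.
move: (q 0 0) (q 1 0) (q 2 0) (q 3 0) (q 0 1) (q 1 1) (q 2 1) (q 3 1).
move=> q00 q10 q20 q30 q01 q11 q21 q31.
by split; apply/matrixP=> i j; rewrite !mxE; ring: e2 d2.
Qed.

(** This is the multiplication table of the quaternion units: [w0], [w1], [w2], [w3] behave as 1, i,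
    j, k, with [a] and [b] acting as i and j. *)
Lemma quat_anti_mul :
  let w0 := quat_anti 0 0 in let w1 := quat_anti 1 0 in
  let w2 := quat_anti 0 1 in let w3 := quat_anti 1 1 in
  ([/\ g a *m w0 = w1, g a *m w1 = - w0, g a *m w2 = w3 & g a *m w3 = - w2]
  * [/\ g b *m w0 = w2, g b *m w1 = - w3, g b *m w2 = - w0 & g b *m w3 = w1]
  * [/\ w0 *m g a = w1, w1 *m g a = - w0, w2 *m g a = - w3 & w3 *m g a = w2]
  * [/\ w0 *m g b = w2, w1 *m g b = w3, w2 *m g b = - w0 & w3 *m g b = - w1]
  )%type.
Proof.
have F2 : 2 = - 1 :> 'F_3 by apply/eqP.
rewrite /quat_anti F2; move: qgr (g a) (g b) qgr_mul => q ga gb qM.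
rewrite !mulmxDl !mulmxDr -!scalemxAl -!scalemxAr !qM.
by do ![split]; apply/matrixP=> i j; rewrite !mxE; ring.
Qed.

Definition quat_antis :=
  [:: quat_anti 0 0; quat_anti 1 0; quat_anti 0 1; quat_anti 1 1].

Lemma quat_anti_ideal : gr_ideal (lspan quat_antis).
Proof.
have [[[[l1 l2 l3 l4] [l5 l6 l7 l8]] [r1 r2 r3 r4]] [r5 r6 r7 r8]] :=
  quat_anti_mul.
apply: (gr_ideal_lspan _ [set a; b]) => // [|u|x u|x u].
- by apply/subsetP=> x; rewrite !inE => /pred2P[]->.
- rewrite !inE => /or4P[]/eqP->;
    by rewrite linearD linearZ addmx_sub ?scalemx_sub ?qgr_id.
- rewrite !inE => /pred2P[]-> /or4P[]/eqP->;
    rewrite (l1, l2, l3, l4, l5, l6, l7, l8) ?linearN ?eqmx_opp;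
    by rewrite mem_lspan // !inE eqxx ?orbT.
- rewrite !inE => /pred2P[]-> /or4P[]/eqP->;
    rewrite (r1, r2, r3, r4, r5, r6, r7, r8) ?linearN ?eqmx_opp;
    by rewrite mem_lspan // !inE eqxx ?orbT.
Qed.

(** A nonzero quaternion over Z_3 need not be invertible: i + j + k has norm 3 = 0. So the proof
    extracts from [v] one basis unit lying in [J], and that unit yields the other three. *)
Lemma quat_anti_minimal : gr_minimal H (lspan quat_antis).
Proof.
rewrite /quat_antis; move: quat_anti_mul => /=.
move: (quat_anti 0 0) (quat_anti 1 0) (quat_anti 0 1) (quat_anti 1 1).
move=> w0 w1 w2 w3 [[[[l1 l2 l3 l4] [l5 l6 l7 l8]]]].
move=> [r1 r2 r3 r4] [r5 r6 r7 r8] m J v idJ Jv.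
case/mem_lspan4=> [c0 [c1 [c2 [c3 v_c]]]] nz_v.
pose w c0 c1 c2 c3 := c0 *: w0 + c1 *: w1 + c2 *: w2 + c3 *: w3.
(* On this ideal a ^+ 2 acts as -1, so that y |-> - a y a and y |-> - b y b are
   the conjugations by a and b. *)
have conj_a d0 d1 d2 d3 :
    g a *m w d0 d1 d2 d3 *m g a = w (- d0) (- d1) d2 d3.
  rewrite !(mulmxDr, mulmxDl) -!scalemxAr -!scalemxAl l1 l2 l3 l4.
  by rewrite !mulNmx r1 r2 r3 r4 /w !(scalerN, scaleNr) ?opprK.
have conj_b d0 d1 d2 d3 :
    g b *m w d0 d1 d2 d3 *m g b = w (- d0) d1 (- d2) d3.
  rewrite !(mulmxDr, mulmxDl) -!scalemxAr -!scalemxAl l5 l6 l7 l8.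
  by rewrite !mulNmx r5 r6 r7 r8 /w !(scalerN, scaleNr) ?opprK.
have Jl x y : x \in H -> (y \in J)%MS -> (g x *m y \in J)%MS.
  by move=> Hx; apply: gr_ideal_mull => //; apply: mem_gr.
have Jproj s x y : x \in H -> (y \in J)%MS ->
    (y + s *: (g x *m y *m g x) \in J)%MS.
  move=> Hx Jy; rewrite linearD linearZ addmx_sub ?scalemx_sub //.
  by rewrite gr_ideal_mulr ?mem_gr ?Jl.
(* The coordinates of this element are those of [v] times (1-s)(1-t), (1-s)(1+t), (1+s)(1-t),
   (1+s)(1+t). Each choice of signs thus keeps a single one, with the factor 4 = 1. *)
have Jproj2 s t : (w c0 c1 c2 c3 + s *: w (- c0) (- c1) c2 c3 +
    t *: (w (- c0) c1 (- c2) c3 + s *: w c0 (- c1) (- c2) c3) \in J)%MS.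
  have mulD (A x y B : 'M_#|H|) :
      A *m (x + s *: y) *m B = A *m x *m B + s *: (A *m y *m B).
    by rewrite mulmxDr mulmxDl -scalemxAr -scalemxAl.
  have := Jproj t b _ Hb (Jproj s a _ Ha Jv).
  rewrite v_c -/(w c0 c1 c2 c3) conj_a mulD !conj_b.
  by rewrite (opprK c0).
have F4 : 4 = 1 :> 'F_3 by apply/eqP.
have Jw0 : (c0 *: w0 \in J)%MS.
  rewrite (_ : _ *: _ = 4 *: (c0 *: w0)); last by rewrite F4 scale1r.
  have := Jproj2 (-1) (-1); congr (mxvec _ <= _)%MS.
  by apply/matrixP=> i j; rewrite !mxE; ring.
have Jw1 : (c1 *: w1 \in J)%MS.
  rewrite (_ : _ *: _ = 4 *: (c1 *: w1)); last by rewrite F4 scale1r.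
  have := Jproj2 (-1) 1; congr (mxvec _ <= _)%MS.
  by apply/matrixP=> i j; rewrite !mxE; ring.
have Jw2 : (c2 *: w2 \in J)%MS.
  rewrite (_ : _ *: _ = 4 *: (c2 *: w2)); last by rewrite F4 scale1r.
  have := Jproj2 1 (-1); congr (mxvec _ <= _)%MS.
  by apply/matrixP=> i j; rewrite !mxE; ring.
have Jw3 : (c3 *: w3 \in J)%MS.
  rewrite (_ : _ *: _ = 4 *: (c3 *: w3)); last by rewrite F4 scale1r.
  have := Jproj2 1 1; congr (mxvec _ <= _)%MS.
  by apply/matrixP=> i j; rewrite !mxE; ring.
have unscale c x : (c *: x \in J)%MS -> c != 0 -> (x \in J)%MS.
  by move=> Jcx nz_c; rewrite -(scalerK nz_c x) linearZ scalemx_sub.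
have JN x : (- x \in J)%MS -> (x \in J)%MS by rewrite linearN eqmx_opp.
have w1_w0 : (w1 \in J)%MS -> (w0 \in J)%MS.
  by move=> Jw; apply/JN; rewrite -l2 Jl.
(* Some coordinate of [v] is nonzero, so its unit is in [J]; left multiplication by [a] or [b], or
   by [b] and then [a], carries it to [w0] up to sign. *)
have w0J : (w0 \in J)%MS.
  have [z0 | /(unscale _ _ Jw0)//] := eqVneq c0 0.
  have [z1 | /(unscale _ _ Jw1)/w1_w0//] := eqVneq c1 0.
  have [z2 | /(unscale _ _ Jw2) Jw] := eqVneq c2 0.
    have [z3 | /(unscale _ _ Jw3) Jw] := eqVneq c3 0.
      by rewrite v_c z0 z1 z2 z3 !scale0r !addr0 eqxx in nz_v.
    by apply: w1_w0; rewrite -l8 Jl.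
  by apply/JN; rewrite -l7 Jl.
have w2J : (w2 \in J)%MS by rewrite -l5 Jl.
apply: lspan_sub => u; rewrite !inE => /or4P[]/eqP-> //.
  by rewrite -l1 Jl.
by rewrite -l3 Jl.
Qed.

(* The terms are the central idempotents e_K; the signs come from 1 / 8 = -1. *)
Lemma quat_char_sum :
  - quat_char 1 1 - quat_char 1 2 - quat_char 2 1 - quat_char 2 2
  + quat_anti 0 0 = 1%:M.
Proof.
have F30 : 3 = 0 :> 'F_3 by apply/eqP.
have F2 : 2 = - 1 :> 'F_3 by apply/eqP.
rewrite /quat_char /quat_anti F2.
(* With 2 read as -1, the left side is -4(1 + a^2) + (a^2 - 1), by an identity with integer
   coefficients. Its difference from 1 is displayed as a multiple of 3, since [ring] does not know
   that 3 = 0. *)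
transitivity (1%:M - 3 *: (qgr 0 0 + qgr 0 0 + qgr 2 0)).
  by rewrite -qgr00; apply/matrixP=> i j; rewrite !mxE; ring.
by rewrite F30 scale0r subr0.
Qed.

Lemma quat_char_ideal eps del : eps ^+ 2 = 1 -> del ^+ 2 = 1 ->
  gr_ideal (lspan [:: quat_char eps del]).
Proof.
move=> e2 d2; have [la lb ra rb] := quat_charM _ _ e2 d2.
apply: (gr_ideal_lspan _ [set a; b]) => // [|u|x u|x u].
- by apply/subsetP=> x; rewrite !inE => /pred2P[]->.
- rewrite inE => /eqP->; rewrite /quat_char.
  by rewrite !(linearD, linearZ) /= !addmx_sub ?scalemx_sub ?qgr_id.
- rewrite !inE => /pred2P[]-> /eqP->; rewrite ?(la, lb) linearZ scalemx_sub //;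
    by rewrite mem_lspan ?mem_head.
- rewrite !inE => /pred2P[]-> /eqP->; rewrite ?(ra, rb) linearZ scalemx_sub //;
    by rewrite mem_lspan ?mem_head.
Qed.

Lemma idCBFG_char :
  [/\ idC H a b = lspan [:: quat_char 1 1],
      idB H a b = lspan [:: quat_char 1 2],
      idF H a b = lspan [:: quat_char 2 1]
    & idG H a b = lspan [:: quat_char 2 2]].
Proof.
have F4 : 2 * 2 = 1 :> 'F_3 by apply/eqP.
by rewrite /quat_char /qgr !expg0 !expg1 !mulg1 !mul1g !mulr1 !mul1r F4 !scale1r.
Qed.

Lemma idI_anti : idI H a b = lspan quat_antis.
Proof. by rewrite /quat_antis /quat_anti /qgr !expg0 !expg1 !mulg1 !mul1g. Qed.

End Quaternion.

(** * The direct decomposition and the list of all ideals *)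

Theorem mainTheorem4 (gT : finGroupType) (H : {group gT}) (a b : gT)
    (quatH : (H \isog 'Q_8)%g)
    (defH : H = [set (a ^+ r * b ^+ s)%g | r : 'I_4, s : 'I_2] :> {set gT})
    (a4 : (a ^+ 4 = 1)%g) (b4 : (b ^+ 4 = 1)%g)
    (a2b2 : (a ^+ 2 = b ^+ 2)%g) (abab : (a * b * a = b)%g) :
  let C := idC H a b in let B := idB H a b in let F := idF H a b in
  let G := idG H a b in let I := idI H a b in
  [/\ [/\ gr_ideal C, gr_ideal B, gr_ideal F, gr_ideal G & gr_ideal I],
      (C + B + F + G + I :=: group_ring 'F_3 H)%MS,
      mxdirect (C + B + F + G + I)
    & forall (m : nat) (J : 'A['F_3]_(m, #|H|)), gr_ideal J ->
        exists2 s : seq 'A['F_3]_#|H|,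
          subseq s [:: C; B; F; G; I] & (J :=: \sum_(K <- s) K)%MS].
Proof.
have Ha : a \in H.
  by rewrite defH; apply/imset2P; exists (inord 1) ord0; rewrite ?inordK ?mulg1.
have Hb : b \in H.
  by rewrite defH; apply/imset2P; exists ord0 (inord 1); rewrite ?inordK ?mul1g.
have genH : H \subset <<[set a; b]>>%g.
  rewrite {1}defH; apply/subsetP=> _ /imset2P[r s _ _ ->].
  by rewrite groupM // groupX // mem_gen // !inE eqxx ?orbT.
(* [defH] and the relations only bound the order by 8, since words might coincide; the isomorphism
   gives equality. *)
have cardH : #|H| = 8.
  by rewrite (card_isog quatH) (@card_quaternion 3).
have [defC defB defF defG] := @idCBFG_char _ H a b.
have defI := @idI_anti _ H a b.
move=> C B F G I.
have F1 : (1 ^+ 2 = 1 :> 'F_3)%R by apply/eqP.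
have F2 : (2 ^+ 2 = 1 :> 'F_3)%R by apply/eqP.
have idealC : gr_ideal C by rewrite /C defC quat_char_ideal.
have idealB : gr_ideal B by rewrite /B defB quat_char_ideal.
have idealF : gr_ideal F by rewrite /F defF quat_char_ideal.
have idealG : gr_ideal G by rewrite /G defG quat_char_ideal.
have idealI : gr_ideal I by rewrite /I defI quat_anti_ideal.
have minKs K : K \in [:: C; B; F; G; I] -> gr_ideal K /\ gr_minimal H K.
  rewrite !inE => /or4P[|||/orP[]]/eqP->; split=> //.
  - by rewrite /C defC; apply: gr_minimal_line.
  - by rewrite /B defB; apply: gr_minimal_line.
  - by rewrite /F defF; apply: gr_minimal_line.
  - by rewrite /G defG; apply: gr_minimal_line.
  by rewrite /I defI; apply: quat_anti_minimal.
have sumE : (\sum_(K <- [:: C; B; F; G; I]) K = C + B + F + G + I)%MS.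
  by rewrite !big_cons big_nil Monoid.mulm1 !addsmxA.
have sum1 : (1%:M \in \sum_(K <- [:: C; B; F; G; I]) K)%MS.
  have sum_mem (x y : 'M['F_3]_#|H|) (U V : 'A_#|H|) :
      (x \in U)%MS -> (y \in V)%MS -> ((x + y)%R \in U + V)%MS.
    by move=> Ux Vy; rewrite GRing.linearD addmx_sub_adds.
  rewrite sumE -(@quat_char_sum _ H a b) /C /B /F /G /I.
  rewrite defC defB defF defG defI.
  have mem_opp (u : 'M['F_3]_#|H|) : ((- u)%R \in lspan [:: u])%MS.
    by rewrite GRing.linearN eqmx_opp mem_lspan ?mem_head.
  apply/sum_mem; last by rewrite mem_lspan ?mem_head.
  by do 3![apply/sum_mem; last apply/mem_opp]; apply/mem_opp.
have [sumR decJ] := minimal_ideals_decomposition _ _ minKs sum1.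
rewrite sumE in sumR; split=> //.
(* Elements of [H] are linearly independent, so the sum has rank 8. Directness asks that this equal
   the sum of the five ranks: one inequality is general, and the other holds because these are at
   most 1, 1, 1, 1 and 4. *)
have rankR : \rank (C + B + F + G + I)%MS = 8.
  by rewrite sumR -cardH; apply/eqP/gring_free.
rewrite mxdirectE /= eqn_leq; apply/andP; split.
  do 3![apply: leq_trans (mxrank_adds_leqif _ _) _; rewrite leq_add2r].
  exact: mxrank_adds_leqif.
rewrite rankR /C /B /F /G /I defC defB defF defG defI.
apply: (@leq_add _ _ 4 4); last exact: rank_lspan.
apply: (@leq_add _ _ 3 1); last exact: rank_lspan.
apply: (@leq_add _ _ 2 1); last exact: rank_lspan.
by apply: (@leq_add _ _ 1 1); exact: rank_lspan.
Qed.
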